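(* For every countable ordinal $\gamma$, the class $\mathcal{L}_{\preceq\mathbb{Z}^\gamma}$ of all (nonempty) linear orders that embed into $\mathbb{Z}^\gamma$ is ccs.
   Context: $L\preceq L'$ means there is an embedding $f:L\to L'$ of linear orders, i.e. $x\le_L y\iff f(x)\le_{L'}f(y)$. $\mathcal{L}_{\preceq L_0}=\{L: L\preceq L_0\}$, where $L$ ranges over nonempty linear orders (up to isomorphism). For an ordinal $\gamma$, $\mathbb{Z}^\gamma$ is the linear order on the set of functions $f:\gamma\to\mathbb{Z}$ with finite support $\mathrm{Supp}(f)=\{\beta<\gamma: f(\beta)\ne0\}$, where $f\le g$ iff $f=g$ or $f(\beta_0)<g(\beta_0)$ for $\beta_0=\max\{\beta\in\mathrm{Supp}(f)\cup\mathrm{Supp}(g): f(\beta)\ne g(\beta)\}$. Equivalently, $\mathbb{Z}^0=\mathbf{1}$ is the one-point order, $\mathbb{Z}^{\gamma+1}=(\mathbb{Z}^\gamma\omega)^*+\mathbb{Z}^\gamma+\mathbb{Z}^\gamma\omega$, and $\mathbb{Z}^\gamma=(\sum_{\beta<\gamma}\mathbb{Z}^\beta\omega)^*+\mathbf{1}+\sum_{\beta<\gamma}\mathbb{Z}^\beta\omega$ for limit $\gamma$ (here $LK$ is $L\times K$ ordered antilexicographically and $*$ denotes the reverse order). A subset $I$ of a linear order $L$ is convex if $x\le_L y\le_L z$ and $x,z\in I$ imply $y\in I$. For $A,B\subseteq L$ write $A\le_L B$ if $a\le_L b$ for all $a\in A$, $b\in B$. A class $\mathcal{L}$ of linear orders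 closed downward under $\preceq$ is ccs (closed under convex sums) if for all $K,K'\in\mathcal{L}$ and every family $(K'_k)_{k\in K}$ of nonempty convex subsets of $K'$ such that $k_0<_K k_1\Rightarrow K'_{k_0}\le_{K'}K'_{k_1}$ for all $k_0,k_1\in K$, we have $\sum_{k\in K}K'_k\in\mathcal{L}$, where $\sum_{k\in K}K'_k=\{(x,k): k\in K, x\in K'_k\}$ ordered antilexicographically. *)

(* Defs.v *)
From HB Require Import structures.
From mathcomp Require Import all_boot all_order all_algebra finmap.
From mathcomp Require Import all_classical.

Set Implicit Arguments.
Unset Strict Implicit.
Unset Printing Implicit Defensive.

Import Order.TTheory GRing.Theory Num.Theory.

Local Open Scope order_scope.

Definition embeds d d' (L : orderType d) (L' : orderType d') : Prop :=
  exists f : L -> L', {mono f : x y / x <= y}.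

Definition order_class := forall d : Order.disp_t, orderType d -> Prop.

(* Linear orders are nonempty by convention. *)
Definition orders_below d0 (L0 : orderType d0) : order_class :=
  fun d L => inhabited L /\ embeds L L0.

Definition downward_closed (C : order_class) : Prop :=
  forall d (L : orderType d) d' (L' : orderType d'),
    C d' L' -> inhabited L -> embeds L L' -> C d L.

Definition order_convex d (L : orderType d) (I : set L) : Prop :=
  forall x y z, x <= y -> y <= z -> I x -> I z -> I y.

Definition set_le d (L : orderType d) (A B : set L) : Prop :=
  forall a b, A a -> B b -> a <= b.

(* The sum over k in K of the suborders (I k) of K', ordered                  *)
(* antilexicographically: the index k is compared first.                      *)
Section OrderSum.
Context (d d' : Order.disp_t) (K : orderType d) (K' : orderType d').
Variable I : K -> set K'.

Definition order_sum := {p : K' * K | p.1 \in I p.2}.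

HB.instance Definition _ := Choice.on order_sum.

Definition order_sum_le (p q : order_sum) : bool :=
  ((val p).2 < (val q).2) ||
  ((val p).2 == (val q).2) && ((val p).1 <= (val q).1).

Fact order_sum_le_refl : reflexive order_sum_le.
Proof. by move=> p; rewrite /order_sum_le eqxx lexx orbT. Qed.

Fact order_sum_le_anti : antisymmetric order_sum_le.
Proof.
move=> [[x k] xk] [[y l] yl]; rewrite /order_sum_le /= => h; apply: val_inj => /=.
by move: h; case: (ltgtP k l) => //= ->; move/le_anti ->.
Qed.

Fact order_sum_le_trans : transitive order_sum_le.
Proof.
move=> [[y l] yl] [[x k] xk] [[z m] zm]; rewrite /order_sum_le /=.
case/orP => [kl | /andP[/eqP -> xy]]; case/orP => [lm | /andP[/eqP <- yz]].
- by rewrite (lt_trans kl lm).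
- by rewrite kl.
- by rewrite lm.
- by rewrite eqxx (le_trans xy yz) orbT.
Qed.

Fact order_sum_le_total : total order_sum_le.
Proof.
move=> [[x k] xk] [[y l] yl]; rewrite /order_sum_le /=.
by case: (ltgtP k l) => //= _; apply: le_total.
Qed.

HB.instance Definition _ := Order.Le_isPOrder.Build Order.default_display
  order_sum order_sum_le_refl order_sum_le_anti order_sum_le_trans.
HB.instance Definition _ := Order.POrder_isTotal.Build Order.default_display
  order_sum order_sum_le_total.

End OrderSum.

Definition ccs (C : order_class) : Prop :=
  downward_closed C /\
  forall d (K : orderType d) d' (K' : orderType d') (I : K -> set K'),
    C d K -> C d' K' ->
    (forall k, (I k !=set0)%classic /\ order_convex (I k)) ->
    (forall k0 k1, k0 < k1 -> set_le (I k0) (I k1)) ->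
    C _ (order_sum I).

(* Z^G: finitely supported functions from G to the integers, compared at the  *)
(* greatest point where they differ. It is meant for G a well-order, with     *)
(* order type the exponent, but is a linear order for every linear order G.   *)
Section ZPower.
Context (d : Order.disp_t) (G : orderType d).

Definition zpower := {fsfun G -> int with 0%R}.

HB.instance Definition _ := Choice.on zpower.

Definition zpower_diff (f g : zpower) : {fset G} :=
  [fset b in finsupp f `|` finsupp g | f b != g b]%fset.

Definition zpower_le (f g : zpower) : bool :=
  (f == g) ||
  [exists b0 : zpower_diff f g,
     [forall b : zpower_diff f g, val b <= val b0] &&
     (f (val b0) < g (val b0))%R].

Fact in_zpower_diff f g b : (b \in zpower_diff f g) = (f b != g b).
Proof.
rewrite !inE /=; case: (finsuppP f b); case: (finsuppP g b) => //=.
Qed.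

Fact zpower_leP (f g : zpower) :
  reflect (f = g \/ exists2 b0, (f b0 < g b0)%R & forall b, b0 < b -> f b = g b)
    (zpower_le f g).
Proof.
apply: (iffP orP) => [[/eqP|/existsP[b0 /andP[/forallP h fg]]]|[->|[b0 fg h]]].
- by left.
- right; exists (val b0) => // b bb0; apply/eqP/negP => /negP nb.
  have bD : b \in zpower_diff f g by rewrite in_zpower_diff.
  by have := h [` bD]%fset; rewrite /= leNgt bb0.
- by left.
- right; have bD : b0 \in zpower_diff f g.
    by rewrite in_zpower_diff; move: fg; rewrite lt_neqAle => /andP[].
  apply/existsP; exists [` bD]%fset; rewrite /= fg andbT.
  apply/forallP => b; rewrite leNgt; apply/negP => /h e.
  by have := fsvalP b; rewrite in_zpower_diff e eqxx.
Qed.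

Fact zpower_le_refl : reflexive zpower_le.
Proof. by move=> f; apply/zpower_leP; left. Qed.

Fact zpower_le_anti : antisymmetric zpower_le.
Proof.
move=> f g /andP[/zpower_leP[//|[b fg hb]] /zpower_leP[//|[c gf hc]]].
case: (ltgtP b c) => [bc|cb|e].
- by move: gf; rewrite (hb _ bc) ltxx.
- by move: fg; rewrite (hc _ cb) ltxx.
- by move: gf; rewrite -e => /(lt_trans fg); rewrite ltxx.
Qed.

Fact zpower_le_trans : transitive zpower_le.
Proof.
move=> g f h /zpower_leP[->//|[b fg hb]] /zpower_leP[<-|[c gh hc]].
  by apply/zpower_leP; right; exists b.
apply/zpower_leP; right; case: (ltgtP b c) => [bc|cb|e].
- exists c; first by rewrite (hb _ bc).
  by move=> x cx; rewrite hb ?hc // (lt_trans bc).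
- exists b; first by rewrite -(hc _ cb).
  by move=> x bx; rewrite hb ?hc // (lt_trans cb).
- subst c; exists b; first exact: lt_trans fg gh.
  by move=> x bx; rewrite hb ?hc.
Qed.

Fact zpower_le_total : total zpower_le.
Proof.
move=> f g; have [->|nfg] := eqVneq f g; first by rewrite zpower_le_refl.
have [b0 b0D] : exists b, b \in zpower_diff f g.
  apply/fset0Pn; apply: contra_neq nfg => D0; apply/fsfunP => b.
  by apply/eqP/negP => /negP; rewrite -in_zpower_diff D0 in_fset0.
have [m _ hm] := @Order.TotalTheory.arg_maxP _ _ (zpower_diff f g)
  [` b0D]%fset xpredT val isT.
have mP b : val m < b -> f b = g b.
  move=> mb; apply/eqP/negP => /negP nb.
  have bD : b \in zpower_diff f g by rewrite in_zpower_diff.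
  by have := hm [` bD]%fset isT; rewrite /= leNgt mb.
have := fsvalP m; rewrite in_zpower_diff neq_lt => /orP[] h; apply/orP.
- by left; apply/zpower_leP; right; exists (val m).
- by right; apply/zpower_leP; right; exists (val m) => // b /mP.
Qed.

HB.instance Definition _ := Order.Le_isPOrder.Build Order.default_display
  zpower zpower_le_refl zpower_le_anti zpower_le_trans.
HB.instance Definition _ := Order.POrder_isTotal.Build Order.default_display
  zpower zpower_le_total.

End ZPower.

(* Main.v *)
Require Import Defs.
From mathcomp Require Import all_boot all_order all_algebra finmap.
From mathcomp Require Import all_classical wochoice.

(** Under pointwise addition, [zpower G] is an ordered abelian group: adding the
    same function to [f] and [g] changes neither the greatest point at which
    they differ nor the sign of the difference there. Now let [K] and [K'] embed
    into [zpower G] by [e] and [e'], and let the subsets [I k] of [K'] be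
    increasing in [k]. If [(x, k) < (y, l)] in the sum of the [I k], then either
    [k = l] and [x < y], or [k < l] and [x <= y]; thus the sum is a chain in the
    componentwise order on [K' * K]. Hence [(x, k) |-> e' x + e k] is strictly
    increasing, and embeds the sum into [zpower G]. *)

Import Order.TTheory GRing.Theory Num.Theory.
Local Open Scope order_scope.

Lemma embeds_trans {d1 d2 d3} {L1 : orderType d1} {L2 : orderType d2}
    {L3 : orderType d3} : embeds L1 L2 -> embeds L2 L3 -> embeds L1 L3.
Proof. by move=> [f fP] [g gP]; exists (g \o f) => x y /=; rewrite gP fP. Qed.

Lemma orders_below_downward_closed d (L : orderType d) :
  downward_closed (orders_below L).
Proof.
by move=> d1 L1 d2 L2 [_ L2L] L1_inh L1L2; split=> //; exact: embeds_trans L2L.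
Qed.

Section ZPowerAdd.
Context {d : Order.disp_t} {G : orderType d}.
Implicit Types f g h : zpower G.

Lemma zpower_ltP f g :
  f < g <->
  exists2 b0, (f b0 < g b0)%R & forall b, b0 < b -> f b = g b.
Proof.
split=> [|[b0 fg hb]].
  by rewrite lt_neqAle => /andP[/eqP nfg /zpower_leP[|]].
rewrite lt_neqAle; apply/andP; split; last by apply/zpower_leP; right; exists b0.
by apply: contraTneq fg => ->; rewrite ltxx.
Qed.

(** Pointwise sum of two finitely supported functions. *)
Definition zpower_add f g : zpower G :=
  [fsfun b in (finsupp f `|` finsupp g)%fset => (f b + g b)%R].

Lemma zpower_addE f g b : zpower_add f g b = (f b + g b)%R.
Proof.
rewrite fsfunE inE; case: (finsuppP f b) => //= _.
by case: (finsuppP g b) => //= _; rewrite addr0.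
Qed.

Lemma zpower_addC f g : zpower_add f g = zpower_add g f.
Proof. by apply/fsfunP => b; rewrite !zpower_addE addrC. Qed.

Lemma ltD2r_zpower h f g : f < g -> zpower_add f h < zpower_add g h.
Proof.
move=> /zpower_ltP[b0 fg hb]; apply/zpower_ltP; exists b0.
  by rewrite !zpower_addE ltrD2r.
by move=> b /hb fgb; rewrite !zpower_addE fgb.
Qed.

Lemma ltD2l_zpower h f g : f < g -> zpower_add h f < zpower_add h g.
Proof. by rewrite !(zpower_addC h); apply: ltD2r_zpower. Qed.

Lemma leD2r_zpower h f g : f <= g -> zpower_add f h <= zpower_add g h.
Proof. by rewrite le_eqVlt => /predU1P[->//|/(ltD2r_zpower h)/ltW]. Qed.

End ZPowerAdd.

Lemma order_sum_leE d1 (K : orderType d1) d2 (K' : orderType d2)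
    (I : K -> set K') (p q : order_sum I) :
  (p <= q) = ((val p).2 < (val q).2) ||
             ((val p).2 == (val q).2) && ((val p).1 <= (val q).1).
Proof. by []. Qed.

Lemma order_sum_embeds_zpower d (G : orderType d) d1 (K : orderType d1)
    d2 (K' : orderType d2) (I : K -> set K') :
  embeds K (zpower G) -> embeds K' (zpower G) ->
  (forall k0 k1, k0 < k1 -> set_le (I k0) (I k1)) ->
  embeds (order_sum I) (zpower G).
Proof.
move=> [e eP] [e' e'P] I_incr.
exists (fun p : order_sum I => zpower_add (e' (val p).1) (e (val p).2)).
apply: le_mono => p q; rewrite [p < q]lt_neqAle => /andP[neq].
have /set_mem Ip := valP p; have /set_mem Iq := valP q.
rewrite order_sum_leE => /orP[kl|/andP[/eqP kl xy]].
  apply: (@lt_le_trans _ _ (zpower_add (e' (val p).1) (e (val q).2))).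
    by apply: ltD2l_zpower; rewrite (leW_mono eP).
  by apply: leD2r_zpower; rewrite e'P; exact: I_incr kl _ _ Ip Iq.
rewrite kl; apply: ltD2r_zpower; rewrite (leW_mono e'P) lt_neqAle xy andbT.
by apply: contra_neq neq => exy; apply: val_inj; rewrite [LHS]surjective_pairing exy kl
  -surjective_pairing.
Qed.

(* A countable ordinal is given as a countable well-order G. *)
Theorem proposition7p6 (d : Order.disp_t) (G : orderType d)
    (G_wo : well_order (<=%O : rel G)) (G_countable : countable [set: G]) :
  ccs (orders_below (zpower G)).
Proof.
split; first exact: orders_below_downward_closed.
move=> d1 K d2 K' I [[k] KG] [_ K'G] I_cvx I_incr; split.
  by have [[x xk] _] := I_cvx k; apply: inhabits; exists (x, k); apply/mem_set.
exact: order_sum_embeds_zpower.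
Qed.
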